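(* Let $\rho\in\mathcal R$ and $A_\rho\in\mathcal B(H_\rho)$. The spectrum of the zero-defect extension $\widetilde A_\rho^{\,0}$ is $$\sigma(\widetilde A_\rho^{\,0})=\begin{cases}\sigma(A_\rho), & Z_\rho=\{0\},\\ \sigma(A_\rho)\cup\{0\}, & Z_\rho\ne\{0\}.\end{cases}$$
   Context: Let $X=\mathbb R^n$ ($n\ge 1$) with its Borel $\sigma$-algebra and Lebesgue measure $\lambda$; functions are complex-valued. Let $\mathcal H=L^2(X,\lambda)$; $\mathcal B(E)$ denotes the bounded linear operators on $E$. Let $\mathcal R=\{\rho\in L^1(X,\lambda):\rho\ge 0\ \lambda\text{-a.e.},\ \int_X\rho\,d\lambda=1\}$. For $\rho\in\mathcal R$ let $H_\rho=L^2(X,\rho\,d\lambda)$, $V_\rho=\{u\in\mathcal H:u=0\ \lambda\text{-a.e. on }\{\rho=0\}\}$ and $Z_\rho=V_\rho^\perp=\{u\in\mathcal H:u=0\ \lambda\text{-a.e. on }\{\rho>0\}\}$. The map $U_\rho:H_\rho\to V_\rho$, $U_\rho[f]_\rho=\sqrt\rho\,f$, is unitary. $Q_\rho u=\mathbf 1_{\{\rho>0\}}u$ is the orthogonal projection of $\mathcal H$ onto $V_\rho$. For $A_\rho\in\mathcal B(H_\rho)$, the aligned operator is $A_\rho^\sharp=U_\rho A_\rho U_\rho^{-1}:V_\rho\to V_\rho$, and the zero-defect extension is $\widetilde A_\rho^{\,0}=A_\rho^\sharp Q_\rho\in\mathcal B(\mathcal H)$. Here $\sigma(A_\rho)$ is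 the spectrum of $A_\rho$ in $\mathcal B(H_\rho)$ and $\sigma(\widetilde A_\rho^{\,0})$ the spectrum in $\mathcal B(\mathcal H)$. *)

(* Defs.v *)
From HB Require Import structures.
From mathcomp Require Import ring lra.
From mathcomp Require Import all_boot all_order all_algebra.
From mathcomp Require Import generic_quotient ring_quotient complex.
From mathcomp Require Import all_classical all_reals all_analysis measurable_realfun.
Set Implicit Arguments.
Unset Strict Implicit.
Unset Printing Implicit Defensive.
Import Order.TTheory GRing.Theory Num.Theory.
Import numFieldNormedType.Exports.
Import complex Normc.
Local Open Scope classical_set_scope.
Local Open Scope ring_scope.
Local Open Scope quotient_scope.

Section complex_facts.
Context {R : realType}.
Implicit Types z w : R[i].

Lemma norm_normc z : `|z| = (normc z)%:C%C.
Proof. by case: z => a b; rewrite normc_def. Qed.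

Lemma normc_ge0 z : 0 <= normc z.
Proof. by case: z => a b; exact: sqrtr_ge0. Qed.

Lemma ler_normcD z w : normc (z + w) <= normc z + normc w.
Proof. by have := ler_normD z w; rewrite !norm_normc -rmorphD /= lecR. Qed.

Lemma sqr_normcE z : normc z ^+ 2 = Re z ^+ 2 + Im z ^+ 2.
Proof. by case: z => a b; rewrite /= sqr_sqrtr// addr_ge0// sqr_ge0. Qed.

Lemma normcRM (r : R) z : normc (r%:C%C * z) = `|r| * normc z.
Proof. by rewrite normcM /= expr0n /= addr0 sqrtr_sqr. Qed.

End complex_facts.

Section cmeasurable.
Context d (T : measurableType d) (R : realType).
Implicit Types f g : T -> R[i].

(* Measurability for the Borel sigma-algebra of R[i], identified with R * R. *)
Definition cmeasurable f :=
  measurable_fun setT (fun x => Re (f x)) /\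
  measurable_fun setT (fun x => Im (f x)).

Lemma cmeasurable0 : cmeasurable (0 : T -> R[i]).
Proof. by split; exact: measurable_cst. Qed.

Lemma cmeasurable_normc f : cmeasurable f ->
  measurable_fun setT (fun x => normc (f x)).
Proof.
case=> mre mim; have -> : (fun x => normc (f x)) =
    (fun x => Num.sqrt (Re (f x) ^+ 2 + Im (f x) ^+ 2)).
  by apply/funext => x; case: (f x).
apply: (measurableT_comp (continuous_measurable_fun (@sqrt_continuous R))).
by apply: measurable_funD; exact: measurable_funX.
Qed.

Lemma cmeasurableD f g : cmeasurable f -> cmeasurable g -> cmeasurable (f + g).
Proof.
move=> [f1 f2] [g1 g2]; split.
  by rewrite (_ : (fun _ => _) = (fun x => Re (f x) + Re (g x)));
    [exact: measurable_funD|apply/funext => x /=; rewrite fctE raddfD].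
by rewrite (_ : (fun _ => _) = (fun x => Im (f x) + Im (g x)));
    [exact: measurable_funD|apply/funext => x /=; rewrite fctE raddfD].
Qed.

Lemma cmeasurableM f g : cmeasurable f -> cmeasurable g -> cmeasurable (f \* g).
Proof.
move=> [f1 f2] [g1 g2]; split.
  rewrite (_ : (fun _ => _) =
      (fun x => Re (f x) * Re (g x) - Im (f x) * Im (g x))).
    by apply: measurable_funB; exact: measurable_funM.
  by apply/funext => x /=; case: (f x) => a b; case: (g x).
rewrite (_ : (fun _ => _) =
    (fun x => Re (f x) * Im (g x) + Im (f x) * Re (g x))).
  by apply: measurable_funD; exact: measurable_funM.
by apply/funext => x /=; case: (f x) => a b; case: (g x).
Qed.

Lemma cmeasurable_real (r : T -> R) : measurable_fun setT r ->
  cmeasurable (fun x => (r x)%:C%C).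
Proof. by move=> mr; split. Qed.

End cmeasurable.

Section L2fun.
Context d (T : measurableType d) (R : realType).
Variable mu : {measure set T -> \bar R}.
Implicit Types f g : T -> R[i].

Definition L2fun : {pred T -> R[i]} := fun f =>
  `[< cmeasurable f /\ finite_norm mu 2%:E (fun x => normc (f x)) >].

Lemma L2funP f : reflect
  (cmeasurable f /\ (\int[mu]_x (normc (f x) ^+ 2)%:E < +oo)%E) (f \in L2fun).
Proof.
have E : finite_norm mu 2%:E (fun x => normc (f x)) =
    (\int[mu]_x (normc (f x) ^+ 2)%:E < +oo)%E :> Prop.
  rewrite /finite_norm unlock /=.
  under eq_integral => x _ do
    rewrite /= ger0_norm ?normc_ge0// powR_mulrn ?normc_ge0//.
  apply/propext; split => [/(@poweR_lty _ _ 2)|/(@poweR_lty _ _ 2^-1)//].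
  rewrite -poweRrM mulVf ?pnatr_eq0// poweRe1//.
  by apply: integral_ge0 => x _; rewrite lee_fin sqr_ge0.
by rewrite -E; exact: asboolP.
Qed.

End L2fun.

Section L2fun_closed.
Context d (T : measurableType d) (R : realType).
Variable mu : {measure set T -> \bar R}.
Implicit Types f g : T -> R[i].

Lemma measurable_sqr_normc f : cmeasurable f ->
  measurable_fun setT (fun x => (normc (f x) ^+ 2)%:E).
Proof.
by move=> mf; apply/measurable_EFinP/measurable_funX/cmeasurable_normc.
Qed.

Lemma L2fun_dominated f (h : T -> R) (k : R) : cmeasurable f -> 0 <= k ->
  measurable_fun setT h -> (forall x, 0 <= h x) ->
  (\int[mu]_x (h x)%:E < +oo)%E ->
  (forall x, normc (f x) ^+ 2 <= k * h x) -> f \in L2fun mu.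
Proof.
move=> mf k0 mh h0 hoo fh; apply/L2funP; split => //.
apply: (@le_lt_trans _ _ (\int[mu]_x (k%:E * (h x)%:E))%E).
  apply: ge0_le_integral => //.
  - by move=> x _; rewrite lee_fin sqr_ge0.
  - exact: measurable_sqr_normc.
  - by apply: measurable_funeM; exact/measurable_EFinP.
  - by move=> x _; rewrite -EFinM lee_fin.
rewrite ge0_integralZl//; last 2 first.
  - exact/measurable_EFinP.
  - by move=> x _; rewrite lee_fin.
by rewrite lte_mul_pinfty.
Qed.

Lemma L2fun_submod_closed : submod_closed (L2fun mu).
Proof.
split.
  apply/L2funP; split; first exact: cmeasurable0.
  rewrite integral0_eq// => x _.
  by rewrite [X in (X ^+ 2)%:E]normc0 expr0n.
move=> a f g /L2funP[mf foo] /L2funP[mg goo].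
have mag : cmeasurable (a *: f + g).
  by apply: cmeasurableD => //; apply: (@cmeasurableM _ _ _ (cst a)) => //.
pose h x := normc (f x) ^+ 2 + normc (g x) ^+ 2.
apply: (@L2fun_dominated (a *: f + g) h (2 * (1 + normc a ^+ 2))) => //.
- by rewrite mulr_ge0// addr_ge0// sqr_ge0.
- by apply: measurable_funD; apply: measurable_funX; exact: cmeasurable_normc.
- by move=> x; rewrite addr_ge0// sqr_ge0.
- under eq_integral do rewrite EFinD.
  rewrite ge0_integralD//; [exact: lte_add_pinfty| | | |].
  + by move=> x _; rewrite lee_fin sqr_ge0.
  + exact: measurable_sqr_normc.
  + by move=> x _; rewrite lee_fin sqr_ge0.
  + exact: measurable_sqr_normc.
- move=> x; rewrite !fctE /h.
  have := ler_normcD (a * f x) (g x); rewrite normcM.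
  have := normc_ge0 (a * f x + g x).
  move: (normc (_ + _)) (normc a) (normc (f x)) (normc (g x)) => n k u v n0 nE.
  have : n ^+ 2 <= (k * u + v) ^+ 2 by rewrite ler_pXn2r// ?nnegrE ?(le_trans n0).
  move=> /le_trans; apply.
  have := sqr_ge0 (k * u - v); have := sqr_ge0 u; have := sqr_ge0 (k * v).
  nra.
Qed.

HB.instance Definition _ := GRing.isSubmodClosed.Build _ _ (L2fun mu)
  L2fun_submod_closed.

End L2fun_closed.

Record L2function d (T : measurableType d) (R : realType)
    (mu : {measure set T -> \bar R}) := MkL2function {
  L2function_val :> T -> R[i] ;
  L2function_valP : L2function_val \in L2fun mu }.

HB.instance Definition _ d (T : measurableType d) (R : realType)
    (mu : {measure set T -> \bar R}) :=
  [isSub of L2function mu for @L2function_val d T R mu].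
HB.instance Definition _ d (T : measurableType d) (R : realType)
    (mu : {measure set T -> \bar R}) := [Choice of L2function mu by <:].
HB.instance Definition _ d (T : measurableType d) (R : realType)
    (mu : {measure set T -> \bar R}) :=
  [SubChoice_isSubLmodule of L2function mu by <:].

Section L2null.
Context d (T : measurableType d) (R : realType).
Variable mu : {measure set T -> \bar R}.

Definition L2null : {pred L2function mu} := fun f =>
  `[< (\forall x \ae mu, f x = 0) >].

Lemma L2nullP (f : L2function mu) :
  reflect (\forall x \ae mu, f x = 0) (f \in L2null).
Proof. exact: asboolP. Qed.

Lemma L2null_submod_closed : submod_closed L2null.
Proof.
split; first by apply/L2nullP/aeW.
move=> a f g /L2nullP f0 /L2nullP g0; apply/L2nullP.
by near=> x; rewrite /= !fctE (near f0 x)// (near g0 x)// scaler0 addr0.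
Unshelve. all: by end_near. Qed.

HB.instance Definition _ := GRing.isSubmodClosed.Build _ _ L2null
  L2null_submod_closed.

End L2null.

(* The library's LspaceType is real-valued and carries no module structure. *)
Section L2.
Context d (T : measurableType d) (R : realType).
Variable mu : {measure set T -> \bar R}.

Definition L2 : Type := Quotient.quot (@L2null d T R mu).
HB.instance Definition _ := Choice.on L2.
HB.instance Definition _ := EqQuotient.on L2.
HB.instance Definition _ := GRing.Zmodule.on L2.
HB.instance Definition _ := isZmodQuotient.Build _ _ _ _ _ L2
  (@pi_zeror _ _ _ _ _ (Quotient.quot (@L2null d T R mu)))
  (@pi_oppr _ _ _ _ _ (Quotient.quot (@L2null d T R mu)))
  (@pi_addr _ _ _ _ _ (Quotient.quot (@L2null d T R mu))).

Definition L2class (f : L2function mu) : L2 := \pi_L2 f.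
Definition L2repr (u : L2) : L2function mu := repr u.

Lemma L2reprK u : L2class (L2repr u) = u.
Proof. exact: reprK. Qed.

Lemma L2classP (f g : L2function mu) :
  L2class f = L2class g <-> (\forall x \ae mu, f x = g x).
Proof.
have E : (f - g \in L2null (mu:=mu)) = (L2class f == L2class g).
  exact: (Quotient.idealrBE (@L2null d T R mu)).
split=> [/eqP|fg]; last apply/eqP; rewrite -E.
  by move=> /L2nullP; apply: filterS => x; rewrite /= !fctE => /subr0_eq.
by apply/L2nullP; apply: filterS fg => x; rewrite /= !fctE => ->; rewrite subrr.
Qed.

Lemma L2reprP (f : L2function mu) :
  (\forall x \ae mu, L2repr (L2class f) x = f x).
Proof. by apply/L2classP; rewrite L2reprK. Qed.

Lemma L2eqP (u v : L2) : u = v <-> (\forall x \ae mu, L2repr u x = L2repr v x).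
Proof. by rewrite -L2classP !L2reprK. Qed.

Lemma L2classD f g : L2class (f + g) = L2class f + L2class g.
Proof. exact: pi_addr. Qed.

Lemma L2class0 : L2class 0 = 0.
Proof. by rewrite -(subrr 0) -[RHS](subrr (L2class 0)) !subrr [RHS]piE. Qed.

Definition L2scale (a : R[i]) (u : L2) : L2 := L2class (a *: L2repr u).

Lemma L2scale_class a f : L2scale a (L2class f) = L2class (a *: f).
Proof.
apply/L2classP; apply: filterS (L2reprP f) => x.
by rewrite /= !fctE => ->.
Qed.

Let L2scaleA a b u : L2scale a (L2scale b u) = L2scale (a * b) u.
Proof. by rewrite -[u]L2reprK !L2scale_class scalerA. Qed.

Let L2scale1 : left_id 1 L2scale.
Proof. by move=> u; rewrite -[u]L2reprK !L2scale_class scale1r. Qed.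

Let L2scaleDr : right_distributive L2scale +%R.
Proof.
move=> a u v; rewrite -[u]L2reprK -[v]L2reprK.
by rewrite -L2classD !L2scale_class scalerDr L2classD.
Qed.

Let L2scaleDl u : {morph L2scale^~ u : a b / a + b}.
Proof.
by move=> a b; rewrite -[u]L2reprK !L2scale_class scalerDl L2classD.
Qed.

HB.instance Definition _ := GRing.Zmodule_isLmodule.Build R[i] L2
  L2scaleA L2scale1 L2scaleDr L2scaleDl.

Lemma L2classZ a f : L2class (a *: f) = a *: L2class f.
Proof. by rewrite -L2scale_class. Qed.

Lemma L2reprD u v :
  (\forall x \ae mu, L2repr (u + v) x = L2repr u x + L2repr v x).
Proof.
have -> : u + v = L2class (L2repr u + L2repr v) by rewrite L2classD !L2reprK.
exact: L2reprP.
Qed.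

Lemma L2reprZ a u : (\forall x \ae mu, L2repr (a *: u) x = a * L2repr u x).
Proof.
have -> : a *: u = L2class (a *: L2repr u) by rewrite L2classZ L2reprK.
exact: L2reprP.
Qed.

Lemma L2repr0 : (\forall x \ae mu, L2repr 0 x = 0).
Proof. by rewrite -L2class0; exact: L2reprP. Qed.

End L2.

Section L2norm.
Context d (T : measurableType d) (R : realType).
Variable mu : {measure set T -> \bar R}.
Local Open Scope ereal_scope.
Implicit Types f g : T -> R[i].

Local Notation N f := ('N[mu]_2%:E[EFin \o (fun x => normc (f x))]).

Lemma L2cmeasurable (f : L2function mu) : cmeasurable f.
Proof. by have /L2funP[] := L2function_valP f. Qed.

Lemma L2integral_lty (f : L2function mu) :
  \int[mu]_x (normc (f x) ^+ 2)%:E < +oo.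
Proof. by have /L2funP[] := L2function_valP f. Qed.

Lemma LnormcE f : N f = (\int[mu]_x (normc (f x) ^+ 2)%:E) `^ 2^-1.
Proof.
rewrite unlock; congr (_ `^ _); apply: eq_integral => x _.
by rewrite /= ger0_norm ?normc_ge0// powR_mulrn ?normc_ge0.
Qed.

Lemma Lnormc_fin (f : L2function mu) : N f \is a fin_num.
Proof.
rewrite ge0_fin_numE ?Lnorm_ge0//.
by rewrite LnormcE poweR_lty// L2integral_lty.
Qed.

Lemma ae_eq_Lnormc f g : cmeasurable f -> cmeasurable g ->
  (\forall x \ae mu, f x = g x) -> N f = N g.
Proof.
move=> mf mg fg; rewrite !LnormcE; congr (_ `^ _).
apply: ae_eq_integral => //; [exact: measurable_sqr_normc..|].
by apply: filterS fg => x -> _.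
Qed.

Lemma LnormcD (f g : L2function mu) : N (f \+ g)%R <= N f + N g.
Proof.
have mf := cmeasurable_normc (L2cmeasurable f).
have mg := cmeasurable_normc (L2cmeasurable g).
apply: le_trans (eminkowski _ mf mg _) => //; last by rewrite lee_fin ler1n.
rewrite unlock; apply: gt0_ler_poweR => //.
- by rewrite in_itv/= leey andbT integral_ge0// => x _; exact: poweR_ge0.
- by rewrite in_itv/= leey andbT integral_ge0// => x _; exact: poweR_ge0.
have mfg : cmeasurable (f \+ g)%R.
  by apply: cmeasurableD; exact: L2cmeasurable.
apply: ge0_le_integral => //.
- by move=> x _; exact: poweR_ge0.
- apply: (measurableT_comp (measurable_poweR _)).
  apply: measurableT_comp => //.
  exact/measurable_EFinP/cmeasurable_normc.
- apply: (measurableT_comp (measurable_poweR _)).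
  apply: measurableT_comp => //.
  exact/measurable_EFinP/measurable_funD.
- move=> x _ /=; rewrite lee_fin ge0_ler_powR ?nnegrE//.
  rewrite !ger0_norm ?normc_ge0//; first exact: ler_normcD.
  by rewrite addr_ge0// normc_ge0.
Qed.

Lemma LnormcZ (a : R[i]) (f : L2function mu) :
  N (fun x => (a * f x)%R) = (normc a)%:E * N f.
Proof.
rewrite !LnormcE; under eq_integral do rewrite normcM exprMn EFinM.
rewrite ge0_integralZl//; [|exact: measurable_sqr_normc (L2cmeasurable f)|
  by move=> x _; rewrite lee_fin sqr_ge0|by rewrite lee_fin sqr_ge0].
rewrite poweRM ?lee_fin ?sqr_ge0//; last first.
  by apply: integral_ge0 => x _; rewrite lee_fin sqr_ge0.
congr *%E; rewrite poweR_EFin powR12_sqrt ?sqr_ge0//.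
by rewrite sqrtr_sqr ger0_norm ?normc_ge0.
Qed.

Definition L2norm (u : L2 mu) : R[i] := (fine (N (L2repr u)))%:C%C.

Lemma L2norm_class (f : L2function mu) : L2norm (L2class f) = (fine (N f))%:C%C.
Proof.
congr (fine _)%:C%C; apply: ae_eq_Lnormc; [exact: L2cmeasurable..|].
exact: L2reprP.
Qed.

Let ler_L2normD (u v : L2 mu) : (L2norm (u + v) <= L2norm u + L2norm v)%R.
Proof.
rewrite -[u]L2reprK -[v]L2reprK -L2classD !L2norm_class -rmorphD /= lecR.
set f := L2repr u; set g := L2repr v.
have fg : N (f + g)%R \is a fin_num by exact: (Lnormc_fin (f + g)%R).
by rewrite -fineD ?Lnormc_fin// fine_le ?fin_numD ?Lnormc_fin//; exact: LnormcD.
Qed.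

Let L2normZ (a : R[i]) (u : L2 mu) : L2norm (a *: u) = (`|a| * L2norm u)%R.
Proof.
rewrite -[u]L2reprK -L2classZ !L2norm_class norm_normc.
rewrite -[RHS](rmorphM (real_complex R)) /=.
congr (_)%:C%C; rewrite -[X in (X * _)%R]/(fine (normc a)%:E).
by rewrite -fineM ?Lnormc_fin// -LnormcZ.
Qed.

Let L2norm0_eq0 (u : L2 mu) : L2norm u = 0%R -> u = 0%R.
Proof.
rewrite -[u]L2reprK L2norm_class -[X in _ = X -> _](rmorph0 (real_complex R)).
move=> /complexI/eqP; rewrite -eqe fineK ?Lnormc_fin// => /eqP.
move=> /Lnorm_eq0_eq0 N0; rewrite -(L2class0 mu); apply/L2classP.
apply: filterS (N0 _ _) => //.
- by move=> x /(_ I) [] /eq0_normc.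
- exact/measurable_EFinP/cmeasurable_normc/L2cmeasurable.
Qed.

HB.instance Definition _ := Lmodule_isNormed.Build R[i] (L2 mu)
  ler_L2normD L2normZ L2norm0_eq0.

Lemma L2normE (u : L2 mu) : `|u|%R = (fine (N (L2repr u)))%:C%C.
Proof. by []. Qed.

End L2norm.

Section L2dot.
Context d (T : measurableType d) (R : realType).
Variable mu : {measure set T -> \bar R}.

Definition cintegral (f : T -> R[i]) : R[i] :=
  ((\int[mu]_x Re (f x)) +i* (\int[mu]_x Im (f x)))%C.

Lemma ae_eq_cintegral f g : cmeasurable f -> cmeasurable g ->
  (\forall x \ae mu, f x = g x) -> cintegral f = cintegral g.
Proof.
move=> [f1 f2] [g1 g2] fg.
by congr (fine _ +i* fine _)%C; apply: ae_eq_integral => //;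
  (try exact: measurableT_comp); apply: filterS fg => x -> _.
Qed.

Lemma cmeasurable_dot (u v : L2 mu) :
  cmeasurable (fun x => (L2repr u x)^*%C * L2repr v x).
Proof.
apply: cmeasurableM; last exact: L2cmeasurable.
have [m1 m2] := L2cmeasurable (L2repr u); split.
  by rewrite (_ : (fun _ => _) = (fun x => Re (L2repr u x)))//;
    apply/funext => x; case: (L2repr u x).
rewrite (_ : (fun _ => _) = (fun x => - Im (L2repr u x))).
  exact: measurableT_comp.
by apply/funext => x; case: (L2repr u x).
Qed.

Definition L2dot (u v : L2 mu) : R[i] :=
  cintegral (fun x => ((L2repr u x)^*%C * L2repr v x)).

Lemma L2dotuu (u : L2 mu) : L2dot u u = `|u| ^+ 2.
Proof.
rewrite /L2dot /cintegral.
rewrite (_ : Rintegral _ _ (fun x => Im _) = 0); last first.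
  rewrite /Rintegral integral0_eq// => x _.
  by case: (L2repr u x) => a b /=; rewrite mulrC mulNr subrr.
rewrite L2normE -[RHS](rmorphXn (real_complex R)) LnormcE; congr (_ +i* _)%C.
rewrite /Rintegral (_ : (\int[mu]_x _)%E =
    (\int[mu]_x (normc (L2repr u x) ^+ 2)%:E)%E); last first.
  apply: eq_integral => x _; rewrite sqr_normcE.
  by case: (L2repr u x) => a b /=; congr EFin; ring.
have : (\int[mu]_x (normc (L2repr u x) ^+ 2)%:E < +oo)%E by exact: L2integral_lty.
have : (0 <= \int[mu]_x (normc (L2repr u x) ^+ 2)%:E)%E.
  by apply: integral_ge0 => x _; rewrite lee_fin sqr_ge0.
case: (\int[mu]_x _)%E => // r; rewrite lee_fin => r0 _ /=.
by rewrite powR12_sqrt// sqr_sqrtr.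
Qed.

Definition orthocomp (S : set (L2 mu)) : set (L2 mu) :=
  [set u | forall v, S v -> L2dot v u = 0].

End L2dot.

Section bounded_operators.
Context {K : numFieldType}.

Record bounded_op (E F : normedModType K) := BoundedOp {
  bop_fun :> {linear E -> F} ;
  bop_bounded : exists M : K, forall x, `|bop_fun x| <= M * `|x| }.

Section comp.
Context {E F G : normedModType K}.
Variables (A : bounded_op F G) (B : bounded_op E F).

Lemma bop_comp_bounded :
  exists M : K, forall x, `|(A \o B : {linear E -> G}) x| <= M * `|x|.
Proof.
have [M AM] := bop_bounded A; have [N BN] := bop_bounded B.
exists (`|M| * `|N|) => x /=; have [->|x0] := eqVneq x 0.
  by rewrite !linear0 !normr0 mulr0.
have xp : 0 < `|x| by rewrite normr_gt0.
have N0 : 0 <= N by rewrite -(pmulr_lge0 _ xp) (le_trans _ (BN x)).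
rewrite (le_trans (AM _))// (ger0_norm N0) -mulrA.
have [->|y0] := eqVneq (B x) 0.
  by rewrite normr0 mulr0 !mulr_ge0.
have yp : 0 < `|B x| by rewrite normr_gt0.
have M0 : 0 <= M by rewrite -(pmulr_lge0 _ yp) (le_trans _ (AM (B x))).
by rewrite (ger0_norm M0) ler_wpM2l.
Qed.

Definition bop_comp : bounded_op E G := BoundedOp bop_comp_bounded.

End comp.

(* Invertibility of $A - z$ in $\mathcal B(E)$: the inverse B is bounded. *)
Definition resolvent_set (E : normedModType K) (A : bounded_op E E) : set K :=
  [set z | exists B : bounded_op E E,
    (forall x, B (A x - z *: x) = x) /\ (forall x, A (B x) - z *: B x = x)].

Definition spectrum (E : normedModType K) (A : bounded_op E E) : set K :=
  ~` resolvent_set A.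

End bounded_operators.

Section multiplication.
Context d (T : measurableType d) (R : realType).
Variables (mu nu : {measure set T -> \bar R}) (w : T -> R).

(* The condition under which $[u] \mapsto [w u]$ is a well-defined contraction
   $L^2(\mu) \to L^2(\nu)$; mulop is that operator. *)
Definition contracting := measurable_fun setT w /\
  forall f : T -> R[i], cmeasurable f ->
  (\int[nu]_x (normc ((w x)%:C%C * f x) ^+ 2)%:E <=
   \int[mu]_x (normc (f x) ^+ 2)%:E)%E.

Hypothesis wP : contracting.

Lemma mulop_subproof (u : L2 mu) :
  (fun x => (w x)%:C%C * L2repr u x) \in L2fun nu.
Proof.
have [mw wle] := wP; apply/L2funP; split.
  by apply: cmeasurableM; [exact: cmeasurable_real|exact: L2cmeasurable].
by rewrite (le_lt_trans (wle _ _))//; [exact: L2cmeasurable|exact: L2integral_lty].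
Qed.

Definition mulop (u : L2 mu) : L2 nu := L2class (MkL2function (mulop_subproof u)).

Lemma mulopE (u : L2 mu) :
  \forall x \ae nu, L2repr (mulop u) x = (w x)%:C%C * L2repr u x.
Proof. exact: L2reprP. Qed.

Lemma contracting_ae (f : T -> R[i]) : cmeasurable f ->
  (\forall x \ae mu, f x = 0) -> \forall x \ae nu, (w x)%:C%C * f x = 0.
Proof.
have [mw wle] := wP; move=> mf f0.
have mwf : cmeasurable (fun x => (w x)%:C%C * f x).
  by apply: cmeasurableM => //; exact: cmeasurable_real.
have i0 : (\int[nu]_x (normc ((w x)%:C%C * f x) ^+ 2)%:E = 0)%E.
  apply/eqP; rewrite eq_le integral_ge0 ?andbT; last first.
    by move=> x _; rewrite lee_fin sqr_ge0.
  rewrite (le_trans (wle _ mf))// (ae_eq_integral (cst 0%E))//.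
  - by rewrite integral0.
  - exact: measurable_sqr_normc.
  - by apply: filterS f0 => x -> _; rewrite normc0 expr0n.
have : (\int[nu]_x `|(normc ((w x)%:C%C * f x) ^+ 2)%:E| = 0)%E.
  by under eq_integral do rewrite gee0_abs ?lee_fin ?sqr_ge0//.
move/(ae_eq_integral_abs nu measurableT (measurable_sqr_normc mwf)).
apply: filterS => x /(_ I) [] /eqP; rewrite expf_eq0 /= => /eqP.
exact: eq0_normc.
Qed.

Lemma mulop_is_linear : linear mulop.
Proof.
move=> a u v; have -> : a *: mulop u + mulop v =
    L2class (a *: MkL2function (mulop_subproof u) +
             MkL2function (mulop_subproof v)).
  by rewrite L2classD L2classZ.
apply/L2classP.
pose h x := L2repr (a *: u + v) x - (a * L2repr u x + L2repr v x).
have mh : cmeasurable h.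
  exact: (L2cmeasurable (L2repr (a *: u + v) - (a *: L2repr u + L2repr v))).
have h0 : \forall x \ae mu, h x = 0.
  apply: filterS2 (L2reprD (a *: u) v) (L2reprZ a u) => x.
  by rewrite /h => -> ->; rewrite subrr.
apply: filterS (contracting_ae mh h0) => x /=.
rewrite /h mulrBr => /subr0_eq ->.
by rewrite mulrDr mulrCA.
Qed.

HB.instance Definition _ :=
  GRing.isLinear.Build R[i] (L2 mu) (L2 nu) _ mulop mulop_is_linear.

Lemma mulop_norm (u : L2 mu) : `|mulop u| <= `|u|.
Proof.
have [mw wle] := wP.
rewrite {1}/Num.norm /= L2norm_class L2normE lecR.
rewrite fine_le//; [exact: Lnormc_fin|exact: Lnormc_fin|].
rewrite !LnormcE gt0_ler_poweR// ?in_itv/= ?leey ?andbT.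
- by apply: integral_ge0 => x _; rewrite lee_fin sqr_ge0.
- by apply: integral_ge0 => x _; rewrite lee_fin sqr_ge0.
- by apply: wle; exact: L2cmeasurable.
Qed.

End multiplication.

Section density.
Context d (T : measurableType d) (R : realType).
Variable mu : {measure set T -> \bar R}.

(* A representative of an element of $\mathcal R$. *)
Record density := Density {
  density_fun :> T -> R ;
  density_integrable : mu.-integrable setT (EFin \o density_fun) ;
  density_ge0 : \forall x \ae mu, 0 <= density_fun x ;
  density_int1 : (\int[mu]_x (density_fun x)%:E = 1)%E }.

Variable rho : density.

Lemma measurable_density : measurable_fun setT rho.
Proof.
by apply/measurable_EFinP; exact: measurable_int (density_integrable rho).
Qed.

Let mrhop : measurable_fun setT (fun x => (Num.max (rho x) 0)%:E).
Proof.
by apply/measurable_EFinP; apply: measurable_maxr => //; exact: measurable_density.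
Qed.

Let rhop_ge0 x : (0 <= (Num.max (rho x) 0)%:E)%E.
Proof. by rewrite lee_fin le_max lexx orbT. Qed.

(* The measure $\rho\,d\mu$. The density is only nonnegative almost everywhere,
   hence the positive part; see wmeasureE. *)
Definition wmeasure (A : set T) : \bar R :=
  (\int[mu]_(x in A) (Num.max (rho x) 0)%:E)%E.

Let wmeasure0 : wmeasure set0 = 0%E.
Proof. by rewrite /wmeasure integral_set0. Qed.

Let wmeasure_ge0 A : (0 <= wmeasure A)%E.
Proof. by apply: integral_ge0 => x _; exact: rhop_ge0. Qed.

Let wmeasure_sigma_additive : semi_sigma_additive wmeasure.
Proof.
move=> /= A mA tA mUA; rewrite /wmeasure ge0_integral_bigcup//.
- by apply: is_cvg_ereal_nneg_natsum_cond => n _ _; exact: wmeasure_ge0.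
- exact: measurable_funTS.
Qed.

HB.instance Definition _ := isMeasure.Build _ _ _ wmeasure
  wmeasure0 wmeasure_ge0 wmeasure_sigma_additive.

Lemma wmeasureE A : measurable A ->
  wmeasure A = (\int[mu]_(x in A) (rho x)%:E)%E.
Proof.
move=> mA; apply: ae_eq_integral => //.
- exact: measurable_funTS.
- by apply: measurable_funTS; apply/measurable_EFinP/measurable_density.
- apply: filterS (density_ge0 rho) => x x0 _.
  by congr EFin; exact/max_idPl.
Qed.

Import HBNNSimple.

Let integral_wmeasure_nnsfun (h : {nnsfun T >-> R}) :
  (\int[wmeasure]_x (h x)%:E =
   \int[mu]_x ((h x)%:E * (Num.max (rho x) 0)%:E))%E.
Proof.
under [LHS]eq_integral do rewrite fimfunE -fsumEFin//.
rewrite [LHS]ge0_integral_fsum//; last 2 first.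
  - by move=> r; exact/measurable_EFinP/measurableT_comp.
  - by move=> n x _; rewrite EFinM nnfun_muleindic_ge0.
under [RHS]eq_integral.
  move=> x xD; rewrite fimfunE -fsumEFin// muleC ge0_mule_fsumr; last first.
    by move=> r; rewrite EFinM nnfun_muleindic_ge0.
  over.
rewrite [RHS]ge0_integral_fsum//; last 2 first.
  - move=> r; apply: emeasurable_funM => //.
    exact/measurable_EFinP/measurableT_comp.
  - by move=> n x _; rewrite mule_ge0// EFinM nnfun_muleindic_ge0.
apply: eq_fsbigr => r _.
rewrite integralZl_indic_nnsfun// integral_indic//= setIT.
under [RHS]eq_integral do rewrite EFinM muleCA.
have [r0|r0] := ltP r 0.
  rewrite (_ : h @^-1` [set r] = set0); last exact: preimage_nnfun0.
  rewrite measure0 mule0 integral0_eq// => x _.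
  by rewrite indic0 mule0 mule0.
rewrite ge0_integralZl//; last 2 first.
- by apply: emeasurable_funM => //; exact/measurable_EFinP.
- by move=> x _; rewrite mule_ge0// lee_fin.
congr *%E; rewrite /wmeasure [LHS]integral_mkcond; apply: eq_integral => x _.
by rewrite patchE indicE; case: ifPn => _; rewrite ?mule1 ?mule0.
Qed.

Lemma ge0_integral_wmeasure (f : T -> \bar R) :
  measurable_fun setT f -> (forall x, 0 <= f x)%E ->
  (\int[wmeasure]_x f x = \int[mu]_x (f x * (Num.max (rho x) 0)%:E))%E.
Proof.
move=> mf f0; pose f_ := nnsfun_approx measurableT mf.
transitivity (limn (fun n => \int[wmeasure]_x (f_ n x)%:E))%E.
  rewrite -monotone_convergence//=.
  - apply: eq_integral => x _; apply/esym/cvg_lim => //=.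
    by apply: cvg_nnsfun_approx => //.
  - by move=> n; exact/measurable_EFinP.
  - by move=> n x _; rewrite lee_fin.
  - by move=> x _ a b ab; rewrite lee_fin//; exact/lefP/nd_nnsfun_approx.
under eq_fun do rewrite integral_wmeasure_nnsfun.
rewrite -monotone_convergence//=.
- apply: eq_integral => x _; apply/cvg_lim => //=.
  apply: cvgeZr => //.
  by apply: cvg_nnsfun_approx => //.
- by move=> n; apply: emeasurable_funM => //; exact/measurable_EFinP.
- by move=> n x _; rewrite mule_ge0// lee_fin.
- move=> x _ a b ab; rewrite lee_wpmul2r// lee_fin.
  exact/lefP/nd_nnsfun_approx.
Qed.

End density.

Lemma contraction_bounded (K : numFieldType) (E F : normedModType K)
    (A : {linear E -> F}) : (forall u, `|A u| <= `|u|) ->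
  exists M : K, forall u, `|A u| <= M * `|u|.
Proof. by move=> A1; exists 1 => u; rewrite mul1r. Qed.

Section weighted_spaces.
Context d (T : measurableType d) (R : realType).
Context {mu : {measure set T -> \bar R}}.
Variable rho : density mu.

Definition Hrho := L2 (wmeasure rho).

(* $V_\rho$ as a set; as a normed space it is Vspace below. *)
Definition Vset : set (L2 mu) :=
  [set u | \forall x \ae mu, rho x = 0 -> L2repr u x = 0].

(* $V_\rho^\perp$; ZsetE below is the pointwise description. *)
Definition Zset : set (L2 mu) := orthocomp Vset.

Definition Vpred : {pred L2 mu} := fun u => `[< Vset u >].

Lemma VpredP u : reflect (Vset u) (u \in Vpred).
Proof. exact: asboolP. Qed.

Lemma Vpred_submod_closed : submod_closed Vpred.
Proof.
split.
  by apply/VpredP; apply: filterS (@L2repr0 _ _ _ mu) => x ->.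
move=> a u v /VpredP Vu /VpredP Vv; apply/VpredP; rewrite /Vset /=.
near=> x => rx0.
rewrite (near (L2reprD (a *: u) v) x)// (near (L2reprZ a u) x)//.
by rewrite (near Vu x)// (near Vv x)// mulr0 addr0.
Unshelve. all: by end_near. Qed.

HB.instance Definition _ := GRing.isSubmodClosed.Build _ _ Vpred
  Vpred_submod_closed.

Record Vspace := MkVspace { Vspace_val : L2 mu ; Vspace_valP : Vspace_val \in Vpred }.

HB.instance Definition _ := [isSub of Vspace for Vspace_val].
HB.instance Definition _ := [Choice of Vspace by <:].
HB.instance Definition _ := [SubChoice_isSubLmodule of Vspace by <:].

Let Vnorm (u : Vspace) : R[i] := `|Vspace_val u|.

Let ler_VnormD u v : Vnorm (u + v) <= Vnorm u + Vnorm v.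
Proof. exact: ler_normD. Qed.

Let VnormZ a u : Vnorm (a *: u) = `|a| * Vnorm u.
Proof. exact: normrZ. Qed.

Let Vnorm0_eq0 u : Vnorm u = 0 -> u = 0.
Proof. by move=> /normr0_eq0 u0; exact: val_inj. Qed.

HB.instance Definition _ := Lmodule_isNormed.Build R[i] Vspace
  ler_VnormD VnormZ Vnorm0_eq0.

Lemma VnormE (u : Vspace) : `|u| = `|Vspace_val u|.
Proof. by []. Qed.

Let mrho := measurable_density rho.

Let msqrt_rho : measurable_fun setT (fun x => Num.sqrt (rho x)).
Proof.
exact: (measurableT_comp (continuous_measurable_fun (@sqrt_continuous R)) mrho).
Qed.

Let integral_H (f : T -> R[i]) : cmeasurable f ->
  (\int[wmeasure rho]_x (normc (f x) ^+ 2)%:E =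
   \int[mu]_x (normc (f x) ^+ 2 * Num.max (rho x) 0)%:E)%E.
Proof.
move=> mf; rewrite ge0_integral_wmeasure//; first exact: measurable_sqr_normc.
by move=> x; rewrite lee_fin sqr_ge0.
Qed.

Let sqr_sqrt_rho x : Num.sqrt (rho x) ^+ 2 = Num.max (rho x) 0.
Proof.
have [r0|r0] := leP 0 (rho x); first by rewrite sqr_sqrtr.
by rewrite ltr0_sqrtr// expr0n.
Qed.

Lemma U_isometry (f : T -> R[i]) : cmeasurable f ->
  (\int[mu]_x (normc ((Num.sqrt (rho x))%:C%C * f x) ^+ 2)%:E =
   \int[wmeasure rho]_x (normc (f x) ^+ 2)%:E)%E.
Proof.
move=> mf; rewrite integral_H//; apply: eq_integral => x _; congr EFin.
by rewrite normcRM exprMn real_normK ?num_real// sqr_sqrt_rho mulrC.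
Qed.

Lemma U_contracting :
  contracting (wmeasure rho) mu (fun x => Num.sqrt (rho x)).
Proof. by split => // f mf; rewrite U_isometry. Qed.

Lemma Uinv_contracting :
  contracting mu (wmeasure rho) (fun x => (Num.sqrt (rho x))^-1).
Proof.
have mw : measurable_fun setT (fun x => (Num.sqrt (rho x))^-1).
  rewrite (_ : (fun _ => _) = (fun x => Num.sqrt (rho x) `^ (-1))); last first.
    by apply/funext => x; rewrite powR_inv1// sqrtr_ge0.
  exact: (measurableT_comp (measurable_powR _)).
split => // f mf.
have mwf : cmeasurable (fun x => ((Num.sqrt (rho x))^-1)%:C%C * f x).
  by apply: cmeasurableM => //; exact: cmeasurable_real.
rewrite integral_H//; apply: ge0_le_integral => //.
- by move=> x _; rewrite lee_fin mulr_ge0 ?sqr_ge0// le_max lexx orbT.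
- apply/measurable_EFinP; apply: measurable_funM.
    exact/measurable_funX/cmeasurable_normc.
  exact: measurable_maxr.
- exact: measurable_sqr_normc.
- move=> x _; rewrite lee_fin normcRM exprMn real_normK ?num_real//.
  rewrite exprVn sqr_sqrt_rho mulrAC.
  have [->|r0] := eqVneq (Num.max (rho x) 0) 0; first by rewrite mulr0 mul0r sqr_ge0.
  by rewrite mulVf// mul1r.
Qed.

Lemma Q_contracting : contracting mu mu (\1_[set x | 0 < rho x]).
Proof.
split.
  apply: measurable_indic; rewrite -[X in measurable X]setTI.
  by rewrite -preimage_itvoy; exact: mrho.
move=> f mf; apply: ge0_le_integral => //.
- by move=> x _; rewrite lee_fin sqr_ge0.
- apply: measurable_sqr_normc; apply: cmeasurableM => //.
  apply: cmeasurable_real; apply: measurable_indic.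
  by rewrite -[X in measurable X]setTI -preimage_itvoy; exact: mrho.
- exact: measurable_sqr_normc.
- move=> x _; rewrite lee_fin normcRM exprMn indicE.
  by case: (_ \in _); rewrite ?normr1 ?normr0 ?expr1n ?expr0n ?mul1r ?mul0r ?sqr_ge0.
Qed.

Lemma U_in_V (f : Hrho) : mulop U_contracting f \in Vpred.
Proof.
apply/VpredP; apply: filterS (mulopE U_contracting f) => x -> r0.
by rewrite r0 sqrtr0 mul0r.
Qed.

Lemma Q_in_V (u : L2 mu) : mulop Q_contracting u \in Vpred.
Proof.
apply/VpredP; apply: filterS (mulopE Q_contracting u) => x -> r0.
by rewrite indicE memNset ?mul0r//= r0 ltxx.
Qed.

Definition U_fun (f : Hrho) : Vspace := MkVspace (U_in_V f).

(* $[u] \mapsto [u / \sqrt\rho]$, using $0^{-1} = 0$ on $\{\rho = 0\}$. *)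
Definition Uinv_fun (u : Vspace) : Hrho := mulop Uinv_contracting (Vspace_val u).

Definition Q_fun (u : L2 mu) : Vspace := MkVspace (Q_in_V u).

Let U_linear : linear U_fun.
Proof. by move=> a f g; apply: val_inj; exact: (linearP (mulop U_contracting)). Qed.

Let Uinv_linear : linear Uinv_fun.
Proof. by move=> a f g; exact: (linearP (mulop Uinv_contracting)). Qed.

Let Q_linear : linear Q_fun.
Proof. by move=> a f g; apply: val_inj; exact: (linearP (mulop Q_contracting)). Qed.

Let incl_linear : linear Vspace_val.
Proof. by []. Qed.

HB.instance Definition _ :=
  GRing.isLinear.Build R[i] Hrho Vspace _ U_fun U_linear.
HB.instance Definition _ :=
  GRing.isLinear.Build R[i] Vspace Hrho _ Uinv_fun Uinv_linear.
HB.instance Definition _ :=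
  GRing.isLinear.Build R[i] (L2 mu) Vspace _ Q_fun Q_linear.
HB.instance Definition _ :=
  GRing.isLinear.Build R[i] Vspace (L2 mu) _ Vspace_val incl_linear.

Definition U_op : bounded_op Hrho Vspace :=
  BoundedOp (contraction_bounded (mulop_norm U_contracting : forall f, `|U_fun f| <= `|f|)).

Definition Uinv_op : bounded_op Vspace Hrho :=
  BoundedOp (contraction_bounded
    (fun u => mulop_norm Uinv_contracting (Vspace_val u) : `|Uinv_fun u| <= `|u|)).

Definition Q_op : bounded_op (L2 mu) Vspace :=
  BoundedOp (contraction_bounded (mulop_norm Q_contracting : forall u, `|Q_fun u| <= `|u|)).

Definition incl_op : bounded_op Vspace (L2 mu) :=
  BoundedOp (contraction_bounded (fun u => lexx `|u| : `|Vspace_val u| <= `|u|)).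

(* $A^\sharp = U_\rho A U_\rho^{-1}$; U_opK and Uinv_opK below show that Uinv_op
   is the inverse of U_op. *)
Definition sharp (A : bounded_op Hrho Hrho) : bounded_op Vspace Vspace :=
  bop_comp U_op (bop_comp A Uinv_op).

(* $\widetilde A_\rho^{\,0} = A_\rho^\sharp Q_\rho$, followed by the inclusion
   $V_\rho \subseteq L^2$. *)
Definition zero_defect_ext (A : bounded_op Hrho Hrho) :
    bounded_op (L2 mu) (L2 mu) :=
  bop_comp incl_op (bop_comp (sharp A) Q_op).

End weighted_spaces.

Section weighted_spaces_theory.
Context d (T : measurableType d) (R : realType).
Context {mu : {measure set T -> \bar R}}.
Variable rho : density mu.

Let mpos : measurable [set x | 0 < rho x].
Proof.
rewrite -[X in measurable X]setTI -preimage_itvoy.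
exact: measurable_density.
Qed.

Lemma wmeasure_ae_gt0 : \forall x \ae wmeasure rho, 0 < rho x.
Proof.
exists (~` [set x | 0 < rho x]); split => //; first exact: measurableC.
rewrite /= /wmeasure; apply: integral0_eq => x /= /negP; rewrite -leNgt => r0.
by congr EFin; exact/max_idPr.
Qed.

Lemma U_opE (f : Hrho rho) : \forall x \ae mu,
  L2repr (Vspace_val (U_op rho f)) x = (Num.sqrt (rho x))%:C%C * L2repr f x.
Proof. exact: mulopE. Qed.

Lemma U_op_isometry (f : Hrho rho) : `|U_op rho f| = `|f|.
Proof.
rewrite VnormE /= /mulop [LHS]L2norm_class L2normE; congr (fine _)%:C%C.
by rewrite !LnormcE U_isometry//; exact: L2cmeasurable.
Qed.

Lemma U_opK : cancel (U_op rho) (Uinv_op rho).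
Proof.
move=> f; apply/L2eqP.
pose h x := L2repr (Vspace_val (U_op rho f)) x - (Num.sqrt (rho x))%:C%C * L2repr f x.
have mh : cmeasurable h.
  exact: (L2cmeasurable (L2repr (Vspace_val (U_op rho f)) -
    MkL2function (mulop_subproof (U_contracting rho) f))).
have h0 : \forall x \ae mu, h x = 0.
  by apply: filterS (U_opE f) => x; rewrite /h => ->; rewrite subrr.
near=> x.
rewrite (near (mulopE (Uinv_contracting rho) (Vspace_val (U_op rho f))) x)//.
have := near (contracting_ae (Uinv_contracting rho) mh h0) x.
rewrite /h mulrBr => /(_ _)/subr0_eq ->//.
rewrite mulrA -rmorphM mulVf ?mul1r//.
by rewrite gt_eqF// sqrtr_gt0; near: x; exact: wmeasure_ae_gt0.
Unshelve. all: by end_near. Qed.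

Lemma Uinv_opK : cancel (Uinv_op rho) (U_op rho).
Proof.
move=> u; apply: val_inj; apply/L2eqP.
pose h x := L2repr (Uinv_op rho u) x -
  ((Num.sqrt (rho x))^-1)%:C%C * L2repr (Vspace_val u) x.
have mh : cmeasurable h.
  exact: (L2cmeasurable (L2repr (Uinv_op rho u) -
    MkL2function (mulop_subproof (Uinv_contracting rho) (Vspace_val u)))).
have h0 : \forall x \ae wmeasure rho, h x = 0.
  apply: filterS (mulopE (Uinv_contracting rho) (Vspace_val u)) => x.
  by rewrite /h => ->; rewrite subrr.
have Vu : Vset rho (Vspace_val u) by apply/VpredP; exact: Vspace_valP.
near=> x.
rewrite (near (U_opE (Uinv_op rho u)) x)//.
have := near (contracting_ae (U_contracting rho) mh h0) x.
rewrite /h mulrBr => /(_ _)/subr0_eq ->//.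
have : 0 <= rho x by near: x; exact: density_ge0.
rewrite le_eqVlt => /predU1P[r0|r0].
  by rewrite -r0 sqrtr0 mul0r (near Vu x).
by rewrite mulrA -rmorphM mulfV ?mul1r// gt_eqF// sqrtr_gt0.
Unshelve. all: by end_near. Qed.

Lemma Q_opE (u : L2 mu) : \forall x \ae mu,
  L2repr (Vspace_val (Q_op rho u)) x = (\1_[set x | 0 < rho x] x)%:C%C * L2repr u x.
Proof. exact: mulopE. Qed.

Lemma Q_op_id (u : Vspace rho) : Q_op rho (Vspace_val u) = u.
Proof.
apply: val_inj; apply/L2eqP.
have Vu : Vset rho (Vspace_val u) by apply/VpredP; exact: Vspace_valP.
near=> x; rewrite (near (Q_opE (Vspace_val u)) x)// indicE.
have : 0 <= rho x by near: x; exact: density_ge0.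
rewrite le_eqVlt => /predU1P[r0|r0].
  by rewrite [X in _ * X](near Vu x)// [RHS](near Vu x)// mulr0.
by rewrite mem_set// mul1r.
Unshelve. all: by end_near. Qed.

Lemma ZsetE :
  Zset rho = [set u | \forall x \ae mu, 0 < rho x -> L2repr u x = 0].
Proof.
apply/seteqP; split => u /= Zu; last first.
  move=> v Vv; have uv : \forall x \ae mu, (L2repr v x)^*%C * L2repr u x = 0.
    near=> x; have : 0 <= rho x by near: x; exact: density_ge0.
    rewrite le_eqVlt => /predU1P[r0|r0].
      by rewrite (near Vv x)// rmorph0 mul0r.
    by rewrite (near Zu x)// mulr0.
  rewrite /L2dot (ae_eq_cintegral (g := cst 0) _ _ uv).
  - by rewrite /cintegral /Rintegral /= integral0.
  - exact: cmeasurable_dot.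
  - exact: cmeasurable0.
pose v := Q_op rho u.
have Vv : Vset rho (Vspace_val v) by apply/VpredP; exact: Vspace_valP.
have v0 : Vspace_val v = 0.
  apply/eqP; rewrite -normr_eq0 -sqrf_eq0 -L2dotuu; apply/eqP.
  rewrite -[RHS](Zu _ Vv).
  apply: ae_eq_cintegral; [exact: cmeasurable_dot..|].
  near=> x; rewrite (near (Q_opE u) x)//.
  by rewrite indicE; case: (_ \in _); rewrite ?mul1r// !mul0r rmorph0 !mul0r.
have {}v0 : \forall x \ae mu, L2repr (Vspace_val v) x = 0.
  by rewrite v0; exact: L2repr0.
near=> x => r0; have := near v0 x; rewrite (near (Q_opE u) x)//.
by rewrite indicE mem_set// mul1r; apply.
Unshelve. all: by end_near. Qed.

Lemma zero_defect_extE (A : bounded_op (Hrho rho) (Hrho rho)) (u : L2 mu) :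
  zero_defect_ext A u = Vspace_val (U_op rho (A (Uinv_op rho (Q_op rho u)))).
Proof. by []. Qed.

End weighted_spaces_theory.

Section lebesgue_Rn.
Context {R : realType}.
Local Notation R1 := (measurableTypeR R).

Definition Rn_cons n (p : R1 * n.-tuple R1) : n.+1.-tuple R1 :=
  [tuple of p.1 :: p.2].

Lemma measurable_Rn_cons n : measurable_fun setT (@Rn_cons n).
Proof. exact: (measurable_cons measurable_fst measurable_snd). Qed.

Section succ.
Context n (m : {sigma_finite_measure set (n.-tuple R1) -> \bar R}).

Definition lebesgue_succ : set (n.+1.-tuple R1) -> \bar R :=
  pushforward (@lebesgue_measure R \x m)%E (@Rn_cons n).

Let lebesgue_succ0 : lebesgue_succ set0 = 0%E.
Proof. by rewrite /lebesgue_succ /pushforward preimage_set0 measure0. Qed.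

Let lebesgue_succ_ge0 A : (0 <= lebesgue_succ A)%E.
Proof. by apply: integral_ge0 => x _; exact: measure_ge0. Qed.

Let mcons A : measurable A -> measurable (@Rn_cons n @^-1` A).
Proof.
by move=> mA; rewrite -[X in measurable X]setTI; exact: measurable_Rn_cons.
Qed.

Let lebesgue_succ_sigma_additive : semi_sigma_additive lebesgue_succ.
Proof.
move=> F mF tF mUF; rewrite /lebesgue_succ /pushforward preimage_bigcup.
apply: measure_semi_sigma_additive.
- by move=> i; exact: mcons.
- apply/trivIsetP => /= i j _ _ ij; rewrite -preimage_setI.
  by move/trivIsetP : tF => /(_ _ _ _ _ ij) ->//; rewrite preimage_set0.
- by rewrite -preimage_bigcup; exact: mcons.
Qed.

HB.instance Definition _ := isMeasure.Build _ _ _ lebesgue_succ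
  lebesgue_succ0 lebesgue_succ_ge0 lebesgue_succ_sigma_additive.

Lemma lebesgue_succE (A : set R1) (B : set (n.-tuple R1)) :
  measurable A -> measurable B ->
  lebesgue_succ [set t | A (thead t) /\ B [tuple of behead t]] =
  (lebesgue_measure A * m B)%E.
Proof.
move=> mA mB; rewrite -product_measure1E// /lebesgue_succ /pushforward.
congr product_measure1; apply/seteqP.
have tE (t : n.-tuple R1) x : [tuple of behead [tuple of x :: t]] = t.
  exact: val_inj.
by split => -[x t] /=; rewrite theadE tE.
Qed.

Let lebesgue_succ_sigma_finite : sigma_finite setT lebesgue_succ.
Proof.
have /sigma_finiteP[F [TF ndF Foo]] := sigma_finiteT (@lebesgue_measure R).
have /sigma_finiteP[G [TG ndG Goo]] := sigma_finiteT m.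
exists (fun k => [set t | F k (thead t) /\ G k [tuple of behead t]]).
  apply/esym/seteqP; split => // t _.
  have [i _ Fi] : (\bigcup_i F i) (thead t) by rewrite -TF.
  have [j _ Gj] : (\bigcup_i G i) [tuple of behead t] by rewrite -TG.
  exists (maxn i j) => //; split.
    by move: Fi; exact/subsetPset/ndF/leq_maxl.
  by move: Gj; exact/subsetPset/ndG/leq_maxr.
move=> k; have [mF Fk] := Foo k; have [mG Gk] := Goo k; split; last first.
  by rewrite lebesgue_succE// lte_mul_pinfty// ge0_fin_numE.
apply: measurableI.
- rewrite -[X in measurable X]setTI.
  exact: (@measurable_tnth _ _ n.+1 ord0 measurableT _ mF).
- rewrite -[X in measurable X]setTI.
  exact: (@measurable_behead _ _ n measurableT _ mG).
Qed.

HB.instance Definition _ := Measure_isSigmaFinite.Build _ _ _ lebesgue_succ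
  lebesgue_succ_sigma_finite.

End succ.

(* Lebesgue measure on the Borel sets of $\mathbb R^n$, as the iterated product
   of the one-dimensional Lebesgue measure. *)
Fixpoint lebesgue_Rn n : {sigma_finite_measure set (n.-tuple R1) -> \bar R} :=
  match n with
  | 0%N => \d_([tuple] : 0.-tuple R1)
  | n'.+1 => lebesgue_succ (lebesgue_Rn n')
  end.

Lemma lebesgue_Rn_box n (A : 'I_n -> set R1) : (forall i, measurable (A i)) ->
  lebesgue_Rn n [set t | forall i, A i (tnth t i)] =
  (\prod_(i < n) lebesgue_measure (A i))%E.
Proof.
elim: n A => [|n IHn] A mA.
  by rewrite big_ord0 /= diracE mem_set// => -[].
have mB : measurable [set t : n.-tuple R1 | forall i, A (lift ord0 i) (tnth t i)].
  rewrite (_ : [set _ | _] =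
      \big[setI/setT]_(i < n) [set t | A (lift ord0 i) (tnth t i)]).
    apply: bigsetI_measurable => i _; rewrite -[X in measurable X]setTI.
    exact: (@measurable_tnth _ _ n i measurableT _ (mA (lift ord0 i))).
  apply/seteqP; split => t /=; rewrite -bigcap_seq_cond/= => At.
    by move=> i _; exact: At.
  by move=> i; apply: At; rewrite /= mem_index_enum.
rewrite big_ord_recl -IHn// -lebesgue_succE//=; congr lebesgue_succ.
apply/seteqP; split => t /= At.
  split; first exact: At.
  by move=> i; have := At (lift ord0 i); rewrite [t in tnth t _]tuple_eta tnthS.
move: At => [A0 AS] i; rewrite [t in tnth t _]tuple_eta.
by case: (unliftP ord0 i) => [j|] ->; rewrite ?tnthS ?tnth0//; exact: AS.
Qed.

End lebesgue_Rn.

(* Main.v *)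
(* Write the extension as [J A P] with [J] the inclusion after [U] and
   [P = U^-1 Q], so that [P J = 1] and [1 - J P] projects onto [Z].  If [B]
   inverts [A - z] then [J B P - z^-1 (1 - J P)] inverts [J A P - z], and if [S]
   inverts [J A P - z] then [P S J] inverts [A - z].  Only [z = 0] is special:
   [J A P] kills the range of [1 - J P]. *)
Require Import Defs.
From mathcomp Require Import all_boot all_order all_algebra.
From mathcomp Require Import complex.
From mathcomp Require Import all_classical all_reals all_analysis.

Set Implicit Arguments.
Unset Strict Implicit.
Unset Printing Implicit Defensive.
Import Order.TTheory GRing.Theory Num.Theory.
Import numFieldNormedType.Exports.

Local Open Scope classical_set_scope.
Local Open Scope ring_scope.

Section bounded_op_algebra.
Context {K : numFieldType} {E F : normedModType K}.

Lemma bop_id_bounded : exists M : K, forall x : E, `|idfun x| <= M * `|x|.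
Proof. exact: contraction_bounded. Qed.

Definition bop_id : bounded_op E E := BoundedOp bop_id_bounded.

Lemma bop_sub_bounded (A B : bounded_op E F) :
  exists M : K, forall x, `|(A \- B) x| <= M * `|x|.
Proof.
have [M AM] := bop_bounded A; have [N BN] := bop_bounded B.
by exists (M + N) => x; rewrite mulrDl (le_trans (ler_normB _ _))// lerD.
Qed.

Definition bop_sub (A B : bounded_op E F) : bounded_op E F :=
  BoundedOp (bop_sub_bounded A B).

Lemma bop_scale_bounded (a : K) (A : bounded_op E F) :
  exists M : K, forall x, `|(a \*: A) x| <= M * `|x|.
Proof.
have [M AM] := bop_bounded A.
by exists (`|a| * M) => x; rewrite normrZ -mulrA ler_wpM2l.
Qed.

Definition bop_scale (a : K) (A : bounded_op E F) : bounded_op E F :=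
  BoundedOp (bop_scale_bounded a A).

End bounded_op_algebra.

Section compression.
Context {K : numFieldType} {E H : normedModType K}.
Variables (J : bounded_op E H) (P : bounded_op H E) (A : bounded_op E E).
Hypothesis JK : cancel J P.

Let T := bop_comp J (bop_comp A P).

Let shiftE (F G : normedModType K) (C : bounded_op F G) (x y : F) z :
  C (x - z *: y) = C x - z *: C y.
Proof. by rewrite linearB linearZ. Qed.

Lemma resolvent_compression z : resolvent_set T z -> resolvent_set A z.
Proof.
move=> [S [SK TK]]; exists (bop_comp P (bop_comp S J)); split => x /=.
  (* As [P (J x) = x], the vector [J (A x - z *: x)] is [T - z] applied to [J x]. *)
  by have := SK (J x); rewrite /= JK -shiftE => ->.
by have := congr1 P (TK (J x)); rewrite shiftE /= !JK.
Qed.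

(** Either alternative lets [z] and [z^-1] cancel on the range of [1 - J P]: [z] is invertible, or
    that range is zero and the default [0^-1 = 0] is harmless. *)
Lemma compression_resolvent z : z != 0 \/ cancel P J ->
  resolvent_set A z -> resolvent_set T z.
Proof.
move=> zP [B [BK AK]].
have zK x : z *: (z^-1 *: (x - J (P x))) = x - J (P x).
  case: zP => [z0|->]; last by rewrite subrr !scaler0.
  by rewrite scalerA divff// scale1r.
have zK' x : z^-1 *: (z *: (x - J (P x))) = x - J (P x).
  by rewrite scalerA mulrC -scalerA zK.
exists (bop_sub (bop_comp J (bop_comp B P))
          (bop_scale z^-1 (bop_sub bop_id (bop_comp J P)))).
split => x /=.
  rewrite shiftE JK BK shiftE.
  (* [1 - J P] kills the range of [J], so only the [z] term survives. *)
  have -> : J (A (P x)) - z *: x - (J (A (P x)) - z *: J (P x)) =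
      - (z *: (x - J (P x))).
    by rewrite opprB addrC addrA subrK scalerBr opprB.
  by rewrite scalerN opprK zK' subrKC.
(* [P] kills the range of [1 - J P]. *)
have -> : P (J (B (P x)) - z^-1 *: (x - J (P x))) = B (P x).
  by rewrite shiftE JK linearB /= JK subrr scaler0 subr0.
by rewrite scalerBr zK opprB addrCA -shiftE AK subrK.
Qed.

Lemma spectrum_compression_onto : cancel P J -> spectrum T = spectrum A.
Proof.
move=> PK; congr (~` _); apply/seteqP; split => z.
  exact: resolvent_compression.
by apply: compression_resolvent; right.
Qed.

Lemma spectrum_compression : ~ cancel P J ->
  spectrum T = spectrum A `|` [set 0].
Proof.
(* By De Morgan, it remains to show that the resolvent set of [T] is that of [A] without [0]. *)
move=> PK; rewrite /spectrum -[X in _ `|` X]setCK -setCI; congr (~` _).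
apply/seteqP; split => z /=; last first.
  by move=> [Az /eqP z0]; apply: compression_resolvent Az; left.
move=> Tz; split; first exact: resolvent_compression.
(* [T] kills [x - J (P x)], so a left inverse of [T] forces [J (P x) = x]. *)
move=> z0; move: Tz; rewrite z0 => -[S [SK _]]; apply: PK => x.
have := SK (x - J (P x)).
rewrite /= [P (_ - _)]linearB /= JK subrr !linear0 scale0r subr0 linear0.
by move=> /esym/subr0_eq/esym.
Qed.

End compression.

Section zero_defect.
Context d (T : measurableType d) (R : realType).
Context {mu : {measure set T -> \bar R}}.
Variable rho : density mu.

Let J := bop_comp (incl_op rho) (U_op rho).
Let P := bop_comp (Uinv_op rho) (Q_op rho).

Let JPE u : J (P u) = Vspace_val (Q_op rho u).
Proof. by rewrite -[in RHS](Uinv_opK (Q_op rho u)). Qed.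

Let JK : cancel J P.
Proof.
by move=> f; exact: etrans (congr1 (Uinv_op rho) (Q_op_id _)) (U_opK f).
Qed.

Lemma Zset0 : Zset rho 0.
Proof. by rewrite ZsetE; apply: filterS (@L2repr0 _ _ _ mu) => x ->. Qed.

(** [Zset rho] is the range of [1 - Q]. This turns the case split on [Zset rho] into whether [P] is
    injective with inverse [J]. *)
Lemma Zset_eq0 :
  Zset rho = [set 0] <-> forall u, Vspace_val (Q_op rho u) = u.
Proof.
split=> [Z0 u|QK]; last first.
  apply/seteqP; split => [u|_ ->]; last exact: Zset0.
  rewrite ZsetE => Zu /=; rewrite -(QK u); apply/L2eqP.
  near=> x; rewrite (near (Q_opE rho u) x)// (near (@L2repr0 _ _ _ mu) x)//.
  rewrite indicE; have [r0|r0] := pselect (0 < rho x).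
    by rewrite (near Zu x)// mulr0.
  by rewrite memNset// mul0r.
apply/esym/subr0_eq; have : Zset rho (u - Vspace_val (Q_op rho u)).
  (* Subtraction becomes addition of a multiple by [-1], so that [L2reprD] and [L2reprZ] give the
     representative. *)
  rewrite ZsetE -scaleN1r /=; near=> x => r0.
  rewrite (near (L2reprD u (-1 *: Vspace_val (Q_op rho u))) x)//.
  rewrite (near (L2reprZ (-1) (Vspace_val (Q_op rho u))) x)//.
  rewrite (near (Q_opE rho u) x)// indicE mem_set//.
  by rewrite mul1r mulN1r subrr.
by rewrite Z0.
Unshelve. all: by end_near. Qed.

Lemma spectrum_zero_defect_ext (A : bounded_op (Hrho rho) (Hrho rho)) :
  (Zset rho = [set 0] -> spectrum (zero_defect_ext A) = spectrum A) /\
  (Zset rho <> [set 0] ->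
     spectrum (zero_defect_ext A) = spectrum A `|` [set 0]).
Proof.
have ZP : Zset rho = [set 0] <-> cancel P J.
  by rewrite Zset_eq0; split => PK u; rewrite -[RHS]PK JPE.
(* The two composites are bracketed differently and carry different boundedness proofs, but the
   spectrum sees only the underlying function. *)
have -> : spectrum (zero_defect_ext A) =
    spectrum (bop_comp J (bop_comp A P)) by [].
rewrite ZP; split; first exact: (spectrum_compression_onto A JK).
exact: (spectrum_compression A JK).
Qed.

End zero_defect.

Theorem proposition6p3 (R : realType) (n : nat) (n_gt0 : (0 < n)%N)
    (rho : density (@lebesgue_Rn R n))
    (A : bounded_op (Hrho rho) (Hrho rho)) :
  (Zset rho = [set 0] ->
     spectrum (zero_defect_ext A) = spectrum A) /\
  (Zset rho <> [set 0] ->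
     spectrum (zero_defect_ext A) = spectrum A `|` [set 0]).
Proof. exact: spectrum_zero_defect_ext. Qed.
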